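(* Let $\mathcal{G}$ be a connected multigraph with maximum degree $\Delta$ in which every vertex has at least two distinct neighbors. Then there exists a hypergraph $\mathcal{H}$ with rank $r=\Delta$ such that $\mathcal{L}(\mathcal{H})=\mathcal{G}$.
   Context: A multigraph $\mathcal{G}=(V,E)$ has a finite (here nonempty) vertex set $V$ and a multiset $E$ of edges, each edge being a set of two distinct vertices (no loops). The degree of a vertex is the number of edges containing it, counted with multiplicity. A hypergraph $\mathcal{H}=(V,E)$ consists of a finite set $V$ of vertices and a set $E$ of non-empty subsets of $V$, called hyperedges. All hypergraphs are assumed simple (no hyperedge has cardinality one and no hyperedge is contained in another) and connected. A multigraph or hypergraph is connected if any two vertices are joined by a path, i.e. an alternating sequence of distinct vertices and (hyper)edges in which each (hyper)edge contains the vertices immediately before and after it. The rank of $\mathcal{H}$ is the largest cardinality of its hyperedges. The line multigraph $\mathcal{L}(\mathcal{H})$ is the multigraph with vertex set $E(\mathcal{H})$ in which two distinct vertices $e,f$ are joined by exactly $|e\cap f|$ edges. The equality $\mathcal{L}(\mathcal{H})=\mathcal{G}$ is understood up to identification of vertices: there is a bijection $u\mapsto e_u$ from $V(\mathcal{G})$ to $E(\mathcal{H})$ such that for all distinct $u,w\in V(\mathcal{G})$ the number of edges of $\mathcal{G}$ joining $u$ and $w$ is $|e_u\cap e_w|$. *)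

(* Defs.v *)
From mathcomp Require Import all_boot.
From mathcomp Require Import finmap multiset.

Set Implicit Arguments.
Unset Strict Implicit.
Unset Printing Implicit Defensive.

Local Open Scope mset_scope.

Record multigraph := Multigraph {
  mgV : finType;
  mgE : {mset {set mgV}};
  mgE_card2 : forall e, e \in mgE -> #|e| = 2
}.

Record hypergraph := Hypergraph {
  hgV : finType;
  hgE : {set {set hgV}};
  hgE_neq0 : set0 \notin hgE
}.

(* A path x, e1, x1, ..., ek, xk is given by its start x and the sequence
   p = [:: (e1, x1); ...; (ek, xk)]. *)
Fixpoint incident (V : finType) (x : V) (p : seq ({set V} * V)) : bool :=
  if p is (e, y) :: p' then [&& x \in e, y \in e & incident y p'] else true.

Definition is_path (V : finType) (E : pred {set V}) (x : V)
    (p : seq ({set V} * V)) (y : V) : bool :=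
  [&& incident x p, all E (unzip1 p), uniq (unzip1 p),
      uniq (x :: unzip2 p) & last x (unzip2 p) == y].

Definition connected (V : finType) (E : pred {set V}) : Prop :=
  forall x y : V, exists p, is_path E x p y.

(* A path with distinct vertices never uses two parallel edges of a multigraph,
   so only the support of the edge multiset matters. *)
Definition mg_connected (G : multigraph) : Prop :=
  connected (fun e => e \in mgE G).

Definition hg_connected (H : hypergraph) : Prop :=
  connected (fun e => e \in hgE H).

Definition degree (G : multigraph) (v : mgV G) : nat :=
  count (fun e : {set mgV G} => v \in e) (mgE G).

Definition max_degree (G : multigraph) : nat := \max_(v : mgV G) degree v.

Definition neighbors (G : multigraph) (v : mgV G) : {set mgV G} :=
  [set w | [set v; w] \in mgE G].

Definition hg_simple (H : hypergraph) : Prop :=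
  (forall e, e \in hgE H -> #|e| <> 1) /\
  (forall e f, e \in hgE H -> f \in hgE H -> e \subset f -> e = f).

Definition rank (H : hypergraph) : nat := \max_(e in hgE H) #|e|.

Section LineMultigraph.

Variable H : hypergraph.

Definition hyperedge : finType := {e : {set hgV H} | e \in hgE H}.

Definition line_edges : {mset {set hyperedge}} :=
  [fsfun A in [fset A : {set hyperedge} | #|A| == 2]%fset =>
     #|\bigcap_(e in A) val e|].

Lemma line_edges_card2 A : A \in line_edges -> #|A| = 2.
Proof.
rewrite -mset_neq0 fsfunE !inE /=.
by case: ifP => [/eqP|//].
Qed.

Definition line_multigraph : multigraph := Multigraph line_edges_card2.

Lemma line_edgesE (e f : hyperedge) :
  e != f -> line_edges [set e; f] = #|val e :&: val f|.
Proof.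
move=> ef; rewrite fsfunE !inE /= cards2 ef /=.
by rewrite bigcap_setU !big_set1.
Qed.

End LineMultigraph.

Definition mg_isom (G1 G2 : multigraph) : Prop :=
  exists2 phi : mgV G1 -> mgV G2, bijective phi &
    forall u w, u != w -> mgE G2 [set phi u; phi w] = mgE G1 [set u; w].

(* Main.v *)
Require Import Defs.
From mathcomp Require Import all_boot.
From mathcomp Require Import finmap multiset.

(** The hypergraph is the dual of [G]: its vertices are the edges of [G] counted
with multiplicity, and each vertex [v] of [G] gives the hyperedge of all edges
at [v].  This hyperedge has [degree v] elements, and those of [u] and [w] share
exactly the edges joining [u] and [w].  If the hyperedge of [u] were contained
in that of [w] <> [u], all neighbors of [u] would be equal to [w]. *)

Section Paths.

Context {V : finType}.
Implicit Types (E : pred {set V}) (x y z : V) (e : {set V}).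

Lemma incident_cat x p q :
  incident x (p ++ q) = incident x p && incident (last x (unzip2 p)) q.
Proof. by elim: p x => [|[e y] p IHp] x //=; rewrite IHp !andbA. Qed.

Lemma is_path_suffix E x p q z :
  is_path E x (p ++ q) z -> is_path E (last x (unzip2 p)) q z.
Proof.
rewrite /is_path incident_cat /unzip1 /unzip2 !map_cat all_cat cat_uniq.
rewrite -cat_cons cat_uniq last_cat.
case/and5P=> /andP[_ ->] /andP[_ ->] /and3P[_ _ ->] /and3P[_ hasN uniq_q] ->.
(* The start of the suffix is a vertex of the prefix, so by uniqueness it cannot recur in [q]. *)
rewrite /= uniq_q !andbT; apply: contra hasN => last_q.
by apply/hasP; exists (last x (unzip2 p)) => //; apply: mem_last.
Qed.

(* When [x] or [e] already occurs on the path, cut the path there instead. *)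
Lemma path_step E x y z e :
    E e -> x \in e -> y \in e -> (exists p, is_path E y p z) ->
  exists p, is_path E x p z.
Proof.
move=> Ee xe ye [p py].
have [xp|xNp] := boolP (x \in y :: unzip2 p).
  move: xp; rewrite inE => /predU1P[->|/mapP[[f w] fw_p /= xw]].
    by exists p.
  rewrite -{w}xw in fw_p; case/splitPr: fw_p py => p1 p2.
  rewrite -cat_rcons => /is_path_suffix.
  by rewrite /unzip2 map_rcons last_rcons; exists p2.
have [ep|eNp] := boolP (e \in unzip1 p).
  case/mapP: ep => -[f w] fw_p /= ef; rewrite -{f}ef in fw_p.
  case/splitPr: fw_p py xNp => p1 p2 /is_path_suffix p2P xNp.
  (* The suffix starting with [(e, w)] is kept; only its start is replaced by [x], which lies in [e]
     and not on the old path. *)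
  exists ((e, w) :: p2); move: p2P; rewrite /is_path /= xe.
  case/and5P=> /and3P[_ -> ->] -> -> /andP[_ ->] ->; rewrite /= !andbT.
  apply: contra xNp => xwp2.
  by rewrite /unzip2 map_cat -cat_cons mem_cat /= xwp2 orbT.
exists ((e, y) :: p); move: py; rewrite /is_path /= xe ye Ee eNp.
case/and5P=> -> -> -> yp ->; rewrite /= !andbT; exact/andP.
Qed.

End Paths.

Lemma count_sum_mem (T : finType) (P : pred T) (s : seq T) :
  count P s = \sum_(x | P x) count_mem x s.
Proof.
elim: s => [|y s IHs] /=; first by rewrite big1.
rewrite IHs big_split /=; congr (_ + _).
rewrite big_mkcond (bigD1 y) //= eqxx big1 ?addn0; first by case: (P y).
by move=> x; rewrite eq_sym => /negPf->; case: (P x).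
Qed.

Section Dual.

Variable G : multigraph.
Implicit Types (u v w : mgV G) (e : {set mgV G}).

(** The ordinal tells parallel edges apart; a set that is not an edge has multiplicity 0, hence no
    copy. *)
Definition edge_copy : finType := {e : {set mgV G} & 'I_(mgE G e)}.

Definition star v : {set edge_copy} := [set x : edge_copy | v \in tag x].

Lemma mem_star v (x : edge_copy) : (x \in star v) = (v \in tag x).
Proof. by rewrite inE. Qed.

Lemma tag_edge (x : edge_copy) : tag x \in mgE G.
Proof. by rewrite -mset_neq0 -lt0n (leq_ltn_trans _ (ltn_ord (tagged x))). Qed.

Lemma edge_copyP e : e \in mgE G -> exists x : edge_copy, tag x = e.
Proof.
rewrite -mset_neq0 -lt0n => e_gt0.
by exists (Tagged (fun e : {set mgV G} => 'I_(mgE G e)) (Ordinal e_gt0)).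
Qed.

Lemma card_edge_copy (P : pred {set mgV G}) :
  #|[set x : edge_copy | P (tag x)]| = \sum_(e | P e) mgE G e.
Proof.
rewrite -sum1_card.
under [RHS]eq_bigr => e _ do rewrite -[mgE G e]card_ord -sum1_card.
rewrite (sig_big_dep (fun=> P _) (fun=> predT) (fun=> fun=> 1)).
by apply: eq_bigl => x; rewrite inE andbT.
Qed.

Lemma card_star v : #|star v| = degree v.
Proof.
rewrite (card_edge_copy (fun e => v \in e)) /degree count_sum_mem.
by apply: eq_bigr => e _; rewrite count_mem_mset.
Qed.

Lemma edge_eq u w e : u != w -> e \in mgE G -> u \in e -> w \in e ->
  e = [set u; w].
Proof.
move=> uw eE ue we; apply/esym/eqP; rewrite eqEcard cards2 uw mgE_card2 //.
by rewrite subUset !sub1set ue we.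
Qed.

Lemma card_starI u w : u != w -> #|star u :&: star w| = mgE G [set u; w].
Proof.
move=> uw; rewrite (_ : star u :&: star w =
  [set x : edge_copy | tag x == [set u; w]]).
  by rewrite (card_edge_copy (pred1 _)) big_pred1_eq.
apply/setP=> x; rewrite !inE; apply/andP/eqP => [[ux wx]|->].
  by apply: edge_eq => //; apply: tag_edge.
by rewrite !inE !eqxx orbT.
Qed.

Hypothesis G_neighbors : forall v, 2 <= #|neighbors v|.

Lemma two_neighbors v : exists w1 w2,
  [/\ [set v; w1] \in mgE G, [set v; w2] \in mgE G & w1 != w2].
Proof.
by case/card_gt1P: (G_neighbors v) => w1 [w2] []; rewrite !inE; exists w1, w2.
Qed.

Lemma star_sub u w : star u \subset star w -> u = w.
Proof.
move=> /subsetP sub; apply/eqP; apply: contraT => uw.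
have eq_w v : [set u; v] \in mgE G -> v = w.
  case/edge_copyP=> x xE; have := sub x; rewrite !mem_star xE set21 !inE.
  by rewrite eq_sym (negPf uw) eq_sym => /(_ isT)/eqP.
by have [w1 [w2 [/eq_w-> /eq_w->]]] := two_neighbors u; rewrite eqxx.
Qed.

(** Edges to two distinct neighbors give two distinct copies. This makes hyperedges both nonempty
    and not singletons. *)
Lemma star_gt1 v : 1 < #|star v|.
Proof.
have [w1 [w2 [E1 E2 w12]]] := two_neighbors v.
have [[x1 x1E] [x2 x2E]] := (edge_copyP _ E1, edge_copyP _ E2).
apply/card_gt1P; exists x1, x2; rewrite !mem_star x1E x2E !set21; split=> //.
apply: contraNneq w12 => x12; have w2_in : w2 \in [set v; w1].
  by rewrite -x1E x12 x2E set22.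
(* The case [w2 = v] would make the edge [[set v; w2]] a loop. *)
move: w2_in; rewrite !inE => /predU1P[w2v|/eqP->//].
by have := mgE_card2 E2; rewrite w2v setUid cards1.
Qed.

Lemma stars_neq0 : set0 \notin [set star v | v : mgV G].
Proof.
apply/negP => /imsetP[v _ v0].
by have := star_gt1 v; rewrite -v0 cards0.
Qed.

Definition dual : hypergraph := Hypergraph stars_neq0.

Lemma mem_stars v : star v \in hgE dual.
Proof. exact: imset_f. Qed.

Lemma dual_simple : hg_simple dual.
Proof.
split=> [_ /imsetP[v _ ->] | _ _ /imsetP[u _ ->] /imsetP[w _ ->] /star_sub-> //].
by move=> v1; have := star_gt1 v; rewrite v1.
Qed.

Lemma rank_dual : rank dual = max_degree G.
Proof.
(* Since [star] is injective, the maximum over hyperedges can be taken over the vertices of [G]. *)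
rewrite /rank /max_degree big_imset /=; last first.
  by move=> u w _ _ uw; apply: star_sub; rewrite uw.
by apply: eq_bigr => v _; apply: card_star.
Qed.

(** A path of [G] from an end of [x] to an end of [y] dualizes: its vertices become hyperedges and
    its edges become vertices. Repetitions that this may create are removed by [path_step]. *)
Lemma dual_connected : mg_connected G -> hg_connected dual.
Proof.
move=> conG x y.
have end_of (z : edge_copy) : exists v, v \in tag z.
  by apply/card_gt0P; rewrite (mgE_card2 (tag_edge z)).
have [[u ux] [w wy]] := (end_of x, end_of y).
have [p /and5P[incp Ep _ _ /eqP lastp]] := conG u w.
(* [x] varies with [u]: the hyperedge [star u] leads from [x] to a copy [c] of the first edge, which
   then takes the place of [x]. *)
elim: p u x ux incp Ep lastp => [|[e v] p IHp] u x ux /=.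
  move=> _ _ uw; apply: (path_step _ _ y _ (star u)).
  - exact: mem_stars.
  - by rewrite mem_star.
  - by rewrite mem_star uw.
  by exists [::]; rewrite /is_path /= eqxx.
case/and3P=> ue ve incp /andP[/edge_copyP[c cE] Ep] lastp.
apply: (path_step _ _ c _ (star u)).
- exact: mem_stars.
- by rewrite mem_star.
- by rewrite mem_star cE.
by apply: (IHp v) => //; rewrite cE.
Qed.

Lemma line_dual_isom : mg_isom (line_multigraph dual) G.
Proof.
pose psi v : hyperedge dual := exist _ (star v) (mem_stars v).
have psi_inj : injective psi.
  by move=> u w /(congr1 val) /= uw; apply: star_sub; rewrite uw.
have psi_surj h : exists v, psi v == h.
  have /imsetP[v _ hv] := valP h.
  by exists v; apply/eqP/val_inj; rewrite /= -hv.
(* The isomorphism must go from hyperedges to vertices, so the bijection [psi] is inverted by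
   choice. *)
pose phi h := xchoose (psi_surj h).
have phiK : cancel phi psi by move=> h; apply/eqP/(xchooseP (psi_surj h)).
have psiK : cancel psi phi by move=> v; apply: psi_inj; rewrite phiK.
exists phi; first by exists psi.
move=> h k hk; rewrite /= line_edgesE // -{2}(phiK h) -{2}(phiK k) /=.
by rewrite card_starI // (can_eq phiK).
Qed.

End Dual.

Theorem proposition3p13 (G : multigraph)
    (G_nonempty : 0 < #|mgV G|)
    (G_connected : mg_connected G)
    (G_neighbors : forall v : mgV G, 2 <= #|neighbors v|) :
  exists H : hypergraph,
    [/\ hg_simple H, hg_connected H, rank H = max_degree G
      & mg_isom (line_multigraph H) G].
Proof.
exists (dual G G_neighbors); split.
- exact: dual_simple.
- exact: dual_connected.
- exact: rank_dual.
exact: line_dual_isom.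
Qed.
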